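(* Let $k>2$ and $r\ge1$ be integers and let $D_{2^k(2r+1)}=\langle x,y\mid x^{2^k}=1,\ y^{2r+1}=1,\ xyx^{-1}=y^{-1}\rangle$. The conjugacy classes of $D_{2^k(2r+1)}$ are exactly the following $2^{k-1}(r+2)$ sets: - $\{x^{2l}\}$ for $l=0,\dots,2^{k-1}-1$; - $\{x^{2l}y^q,\ x^{2l}y^{-q}\}$ for $l=0,\dots,2^{k-1}-1$ and $q=1,\dots,r$; - $\{x^{2l+1},\ x^{2l+1}y,\ x^{2l+1}y^2,\dots,x^{2l+1}y^{2r}\}$ for $l=0,\dots,2^{k-1}-1$. They have $1$, $2$ and $2r+1$ elements respectively.
   Context: The group $D_{2^k(2r+1)}$ has order $2^k(2r+1)$. *)

(* Defs.v *)
From mathcomp Require Import all_boot all_fingroup all_solvable.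

Set Implicit Arguments.
Unset Strict Implicit.
Unset Printing Implicit Defensive.

Local Open Scope group_scope.

(* G = < x, y | x^(2^k) = y^(2r+1) = 1, x y x^-1 = y^-1 >, with x and y the
   distinguished generators.  [G \isog Grp (...)] binds its generators
   existentially, hence the further conditions on x and y: in a finite group G
   with this presentation, a generating pair satisfying the relations is the
   image of the distinguished pair under an automorphism of G. *)
Definition isD (k r : nat) (gT : finGroupType) (G : {group gT}) (x y : gT)
    : Prop :=
  [/\ G \isog Grp (a : b : a ^+ (2 ^ k)%N = 1, b ^+ (2 * r + 1)%N = 1,
                           a * b * a^-1 = b^-1),
      <<[set x; y]>> = G,
      x ^+ (2 ^ k)%N = 1,
      y ^+ (2 * r + 1)%N = 1
    & x * y * x^-1 = y^-1].

Section CandidateClasses.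

Variables (gT : finGroupType) (x y : gT).

Definition class_even (l : nat) : {set gT} := [set x ^+ (2 * l)%N].

Definition class_pair (l q : nat) : {set gT} :=
  [set x ^+ (2 * l)%N * y ^+ q; x ^+ (2 * l)%N * y ^- q].

Definition class_odd (r l : nat) : {set gT} :=
  [set x ^+ (2 * l + 1)%N * y ^+ j | j : 'I_(2 * r + 1)].

End CandidateClasses.

(* Main.v *)
(* The even powers of x are central, y^x = y^-1, and conjugation by y multiplies
   an odd power of x by y^2. Hence x^(2l) y^q is only conjugate to itself and to
   x^(2l) y^-q, while, y having odd order, the class of x^(2l+1) is the whole
   coset x^(2l+1) <y>.  The listed classes are distinct because x^i y^j
   determines i modulo 2^k and j modulo 2r+1, which amounts to x and y having
   their full orders. *)

Require Import Defs.
From mathcomp Require Import all_boot all_fingroup all_solvable.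
From mathcomp Require Import zmodp.

Local Open Scope group_scope.

Lemma dvdn_homg (aT rT : finGroupType) (G : {group aT}) (H : {group rT}) :
  H \homg G -> #|H| %| #|G|.
Proof.
by case/homgP=> f <-; rewrite card_morphim setIid dvdn_indexg.
Qed.

Lemma expg_order_inj (gT : finGroupType) (z : gT) i j :
  i < #[z] -> j < #[z] -> z ^+ i = z ^+ j -> i = j.
Proof.
by move=> lti ltj /eqP; rewrite eq_expg_mod_order !modn_small // => /eqP.
Qed.

(** * Conjugation formulas that follow from the relation between x and y *)

Section Relations.

Variables (gT : finGroupType) (x y : gT).
Hypothesis yx : x * y * x^-1 = y^-1.

(** [y ^ x] is x^-1 y x, whereas the relation conjugates by x^-1; inversion being an involution,
    both conjugations act alike on y. *)
Lemma conj_yx : y ^ x = y^-1.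
Proof.
rewrite conjgE -[y in LHS]invgK -yx !invMg invgK.
by rewrite !mulgA mulVg mul1g mulgKV.
Qed.

Lemma conj_expyx j : (y ^+ j) ^ x = y ^- j.
Proof. by rewrite conjXg conj_yx expgVn. Qed.

Lemma commute_x2y l : commute (x ^+ (2 * l)) y.
Proof.
rewrite expgM; apply/commute_sym/commuteX/commgP/conjg_fixP.
by rewrite expgS expg1 conjgM conj_yx conjVg conj_yx invgK.
Qed.

Lemma conj_x2y l z :
  commute y z -> (x ^+ (2 * l) * z) ^ y = x ^+ (2 * l) * z.
Proof.
move=> cyz; apply/conjg_fixP/commgP/commute_sym/commuteM => //.
exact/commute_sym/commute_x2y.
Qed.

(** As x normalizes [<[y]>], the join of the two cyclic groups is their product set. *)
Lemma gen_norm_cycle : <<[set x; y]>> = <[x]> * <[y]>.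
Proof.
rewrite -norm_joinEl ?norms_cycle ?conj_yx ?groupV ?cycle_id //.
by rewrite joing_idl joing_idr joingE.
Qed.

Lemma conj_expyx_odd l j : (y ^+ j) ^ (x ^+ (2 * l + 1)) = y ^- j.
Proof.
rewrite addn1 expgSr conjgM -conj_expyx; congr (_ ^ x).
by apply/conjg_fixP/commgP/commute_sym/commuteX/commute_x2y.
Qed.

(** Moving y^-j to the right across an odd power of x inverts it. *)
Lemma conj_odd_expyx l j :
  (x ^+ (2 * l + 1)) ^ (y ^+ j) = x ^+ (2 * l + 1) * y ^+ (2 * j).
Proof.
rewrite conjgE mulgA [y ^- j * _]conjgC conjVg conj_expyx_odd // invgK.
by rewrite -mulgA -expgD addnn -mul2n.
Qed.

(** Treats the central elements as degenerate pairs with q = 0, so that one argument computes both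
    kinds of class. *)
Lemma class_even_pair l : class_even x l = class_pair x y l 0.
Proof. by rewrite /class_pair invg1 mulg1 setUid. Qed.

End Relations.

(** * Conjugacy classes when x and y have orders 2m and 2r + 1 *)

Section Classes.

Variables (gT : finGroupType) (G : {group gT}) (x y : gT) (r m : nat).
Hypotheses (yx : x * y * x^-1 = y^-1) (genG : <<[set x; y]>> = G).
Hypotheses (ox : #[x] = (2 * m)%N) (oy : #[y] = (2 * r + 1)%N).
Hypotheses (r_gt0 : 0 < r) (tixy : <[x]> :&: <[y]> = 1).

Let xG : x \in G. Proof. by rewrite -genG mem_gen ?set21. Qed.
Let yG : y \in G. Proof. by rewrite -genG mem_gen ?set22. Qed.

Let norm_gens (S : {set gT}) : x \in 'N(S) -> y \in 'N(S) -> G \subset 'N(S).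
Proof. by move=> xS yS; rewrite -genG gen_subG subUset !sub1set xS. Qed.

(** Conjugation by x swaps the two elements and y fixes each, so they are conjugate and the pair is
    stable under G. *)
Lemma class_pairE l q : class_pair x y l q = (x ^+ (2 * l) * y ^+ q) ^: G.
Proof.
have x2x : (x ^+ (2 * l)) ^ x = x ^+ (2 * l) by rewrite conjXg conjgE mulKg.
have pairV : (x ^+ (2 * l) * y ^+ q) ^ x = x ^+ (2 * l) * y ^- q.
  by rewrite conjMg x2x conj_expyx.
apply/eqP; rewrite eqEsubset subUset !sub1set class_refl -pairV memJ_class //=.
rewrite class_sub_norm ?set21 //; apply: norm_gens; apply/normP.
  rewrite conjUg !conjg_set1 pairV conjMg x2x conjVg conj_expyx // invgK.
  by rewrite setUC.
have cyq : commute y (y ^+ q) by apply: commuteX.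
by rewrite conjUg !conjg_set1 !conj_x2y //; apply: commuteV.
Qed.

Lemma class_oddE l : class_odd x y r l = x ^+ (2 * l + 1) *: <[y]>.
Proof.
apply/setP=> z; apply/imsetP/lcosetP=> [[j _ ->]|[_ /cyclePmin[j ltj ->] ->]].
  by exists (y ^+ j); rewrite ?mem_cycle.
by rewrite oy in ltj; exists (Ordinal ltj).
Qed.

Lemma class_odd_class l : class_odd x y r l = (x ^+ (2 * l + 1)) ^: G.
Proof.
rewrite class_oddE; apply/eqP; rewrite eqEsubset; apply/andP; split.
  apply/subsetP=> _ /lcosetP[_ /cycleP[j ->] ->].
  (* Squaring is onto on <[y]>: r + 1 is an inverse of 2 modulo 2r + 1. *)
  have -> : y ^+ j = y ^+ (2 * (r.+1 * j)).
    have -> : (2 * (r.+1 * j) = (2 * r + 1) * j + j)%N.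
      by rewrite mulnA mulnS addn1 [RHS]addnC -mulSn.
    by rewrite expgD expgM -oy expg_order expg1n mul1g.
  by rewrite -conj_odd_expyx // memJ_class ?groupX.
rewrite class_sub_norm ?mem_lcoset ?mulVg ?group1 //.
(* The coset is stable under x, which normalizes [<[y]>], and under y, which multiplies the
   representative by y^2. *)
apply: norm_gens; apply/normP; rewrite conjsMg conjg_set1.
  have /normP-> : x \in 'N(<[y]>).
    by rewrite -cycle_subG norms_cycle conj_yx // groupV cycle_id.
  by rewrite conjXg conjgE mulKg.
rewrite -[y in _ ^ y]expg1 conj_odd_expyx // conjGid ?cycle_id //.
by rewrite -mulg_set1 -mulgA lcoset_id ?mem_cycle.
Qed.

(** The element c^-1 a = d b^-1 lies in both cyclic groups, hence is trivial. *)
Lemma mulg_cycle_inj a b c d :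
  a \in <[x]> -> b \in <[y]> -> c \in <[x]> -> d \in <[y]> ->
  a * b = c * d -> a = c /\ b = d.
Proof.
move=> ax by_ cx dy abcd.
have ca_db : c^-1 * a = d * b^-1.
  by apply: (mulgI c); rewrite mulKVg mulgA -abcd mulgK.
have /set1gP ca1 : c^-1 * a \in [1 gT].
  by rewrite -tixy inE groupM ?groupV //= ca_db groupM ?groupV.
split; first by rewrite -[a](mulKVg c) ca1 mulg1.
by move: ca1; rewrite ca_db => db1; rewrite -[d](mulgKV b) db1 mul1g.
Qed.

(** Equality would make 2r + 1 divide p + q, but 0 < p + q <= 2r. *)
Lemma expy_neqV p q : p <= r -> 0 < q <= r -> y ^+ p <> y ^- q.
Proof.
move=> le_p /andP[q_gt0 le_q] /(congr1 (fun z => z * y ^+ q)) /=.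
rewrite mulVg -expgD => /eqP; rewrite -order_dvdn oy => /dvdn_leq.
rewrite addn_gt0 q_gt0 orbT => /(_ isT); apply/negP.
by rewrite -ltnNge addn1 ltnS mul2n -addnn leq_add.
Qed.

Lemma expx_even_inj l l' :
  l < m -> l' < m -> x ^+ (2 * l) = x ^+ (2 * l') -> l = l'.
Proof.
move=> ltl ltl' /expg_order_inj; rewrite ox !ltn_pmul2l //.
by move=> /(_ ltl ltl') /eqP; rewrite eqn_pmul2l // => /eqP.
Qed.

Lemma class_pair_inj l q l' q' :
  l < m -> l' < m -> q < r -> q' < r ->
  class_pair x y l q.+1 = class_pair x y l' q'.+1 -> l = l' /\ q = q'.
Proof.
move=> ltl ltl' ltq ltq' eqC.
have : x ^+ (2 * l) * y ^+ q.+1 \in class_pair x y l' q'.+1.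
  by rewrite -eqC set21.
case/set2P=> /mulg_cycle_inj; rewrite ?groupV ?mem_cycle // => -[] //.
  have ltS p : p < r -> p.+1 < #[y].
    by move=> ltp; rewrite oy addn1 ltnS (leq_trans ltp) ?leq_pmull.
  move=> /expx_even_inj-> // eq_y.
  by have [->] := expg_order_inj _ _ _ _ (ltS _ ltq) (ltS _ ltq') eq_y.
(* Matching the other member of the pair would equate y^(q+1) with y^-(q'+1), both exponents being
   at most r. *)
by move=> _ /expy_neqV[].
Qed.

Lemma class_odd_inj l l' :
  l < m -> l' < m -> class_odd x y r l = class_odd x y r l' -> l = l'.
Proof.
move=> ltl ltl'; rewrite !class_oddE => eqC.
have : x ^+ (2 * l + 1) \in x ^+ (2 * l' + 1) *: <[y]>.
  by rewrite -eqC mem_lcoset mulVg.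
case/lcosetP=> b by_; rewrite -[x ^+ (2 * l + 1)]mulg1.
case/mulg_cycle_inj; rewrite ?mem_cycle // => /eqP.
(* Cancelling one factor x reduces to even exponents. *)
rewrite !addn1 !expgSr => /eqP/mulIg.
by move/expx_even_inj=> ->.
Qed.

Lemma card_class_pair l q : 0 < q <= r -> #|class_pair x y l q| = 2.
Proof.
case/andP=> q_gt0 le_q; rewrite cards2 (_ : _ != _) //.
by apply/eqP=> /mulgI/expy_neqV; apply=> //; rewrite q_gt0.
Qed.

Lemma card_class_odd l : #|class_odd x y r l| = (2 * r + 1)%N.
Proof. by rewrite class_oddE card_lcoset -oy. Qed.

Lemma mem_class_odd l j : x ^+ (2 * l + 1) * y ^+ j \in class_odd x y r l.
Proof. by rewrite class_oddE mem_lcoset mulKg mem_cycle. Qed.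

(** Write an element as x^i y^j with i < 2m and j <= 2r: odd i gives a coset; even i gives a
    singleton if j = 0 and a pair otherwise. *)
Lemma classes_listed :
  classes G =
    [set class_even x l | l : 'I_m]
    :|: [set class_pair x y l q.+1 | l : 'I_m, q : 'I_r]
    :|: [set class_odd x y r l | l : 'I_m].
Proof.
have x2G l : x ^+ l \in G by rewrite groupX.
have y2G l : y ^+ l \in G by rewrite groupX.
apply/setP=> C; rewrite !inE; apply/imsetP/idP=> [[g gG ->{C}] | ].
  have : g \in <[x]> * <[y]> by rewrite -gen_norm_cycle // genG.
  case/mulsgP=> _ _ /cyclePmin[i lti ->] /cyclePmin[j ltj ->] ->{g gG}.
  rewrite ox in lti; rewrite oy addn1 ltnS in ltj.
  have [l ltl ->] : exists2 l, l < m & i = (2 * l + odd i)%N.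
    exists i./2; last by rewrite mul2n addnC odd_double_half.
    by rewrite ltn_half_double -mul2n.
  case: (odd i).
    apply/orP; right; apply/imsetP; exists (Ordinal ltl) => //=.
    rewrite class_odd_class; apply/class_eqP; rewrite -class_odd_class.
    exact: mem_class_odd.
  rewrite addn0; apply/orP; left.
  have [j0|j_gt0] := posnP j.
    apply/orP; left; apply/imsetP; exists (Ordinal ltl) => //=.
    by rewrite j0 (class_even_pair _ x y) class_pairE.
  apply/orP; right; have [le_jr|lt_rj] := leqP j r.
    have ltq : j.-1 < r by rewrite prednK.
    apply/imset2P; exists (Ordinal ltl) (Ordinal ltq) => //=.
    by rewrite prednK // class_pairE.
  (* For j > r, y^j is the inverse of y^(2r+1-j); the witness is one less because the index q stands
     for the exponent q + 1. *)
  have ltq : 2 * r - j < r by rewrite ltn_subLR // mul2n -addnn ltn_add2r.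
  apply/imset2P; exists (Ordinal ltl) (Ordinal ltq) => //=.
  rewrite class_pairE; apply/class_eqP; rewrite -class_pairE.
  have -> : y ^+ j = y ^- (2 * r - j).+1.
    apply/eqP; rewrite eq_sym eq_invg_mul -expgD addSn subnK //.
    by rewrite -order_dvdn oy addn1.
  by rewrite set22.
case/orP=> [/orP[/imsetP[l _ ->] | /imset2P[l q _ _ ->]] | /imsetP[l _ ->]].
- exists (x ^+ (2 * l)) => //.
  by rewrite (class_even_pair _ x y) class_pairE mulg1.
- by exists (x ^+ (2 * l) * y ^+ q.+1); rewrite ?groupM // class_pairE.
- by exists (x ^+ (2 * l + 1)); rewrite // class_odd_class.
Qed.

(** The sizes 1, 2 and 2r + 1 > 2 keep the three families disjoint, and each is indexed injectively:
    m + mr + m classes. *)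
Lemma card_classes_listed : #|classes G| = (m * (r + 2))%N.
Proof.
rewrite classes_listed.
set E := imset _ _; set P := imset2 _ _ _; set O := imset _ _.
have cE C : C \in E -> #|C| = 1%N by case/imsetP=> l _ ->; rewrite cards1.
have cP C : C \in P -> #|C| = 2.
  by case/imset2P=> l q _ _ ->; rewrite card_class_pair /=.
have cO C : C \in O -> #|C| = (2 * r + 1)%N.
  by case/imsetP=> l _ ->; rewrite card_class_odd.
have n_gt2 : 2 < 2 * r + 1 by rewrite addn1 ltnS leq_pmulr.
have EP0 : E :&: P = set0.
  by apply/setP=> C; rewrite !inE; apply/andP=> -[/cE cardC /cP]; rewrite cardC.
have EPO0 : (E :|: P) :&: O = set0.
  apply/setP=> C; rewrite !inE; apply/andP=> -[/orP EPC /cO cardC].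
  by move: n_gt2; rewrite -cardC; case: EPC => [/cE | /cP] ->.
rewrite !cardsU EP0 EPO0 cards0 !subn0.
have -> : #|E| = m.
  rewrite card_imset ?card_ord // => l l' /set1_inj /expx_even_inj ll'.
  by apply/val_inj/ll'.
have -> : #|O| = m.
  rewrite card_imset ?card_ord // => l l' /class_odd_inj ll'.
  by apply/val_inj/ll'.
have -> : #|P| = (m * r)%N.
  have -> : P = [set class_pair x y u.1 u.2.+1 | u : 'I_m * 'I_r].
    apply/setP=> C; apply/imset2P/imsetP=> [[l q _ _ ->] | [[l q] _ ->]].
      by exists (l, q).
    by exists l q.
  rewrite card_imset ?card_prod ?card_ord // => -[l q] [l' q'].
  by case/class_pair_inj=> //= /val_inj-> /val_inj->.
by rewrite mulnDr muln2 -addnn addnAC addnC.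
Qed.

End Classes.

(* A presentation only bounds the orders from above. For the lower bound, the
   cyclic group of order 2^k (with y sent to 1) and the dihedral group of order
   2(2r+1) are quotients of G, so both coprime numbers divide #|G|. *)
Lemma isD_orders (k r : nat) (gT : finGroupType) (G : {group gT}) (x y : gT) :
  0 < k -> 0 < r -> isD k r G x y -> #[x] = (2 ^ k)%N /\ #[y] = (2 * r + 1)%N.
Proof.
move=> k_gt0 r_gt0 [isoG genG xm yn yx].
have dvm : (2 ^ k)%N %| #|G|.
  have m_gt0 : 0 < 2 ^ k by rewrite expn_gt0.
  (* The additive group of integers modulo 2^k; the modulus is put in successor form to carry the
     group structure. *)
  pose Z := [set: 'I_(2 ^ k).-1.+1]%G.
  have <- : #|Z| = (2 ^ k)%N by rewrite cardsT card_ord prednK.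
  apply: dvdn_homg; rewrite isoG.
  apply/existsP; exists (Zp1, 1).
  rewrite /= !xpair_eqE /= !expg1n !mulg1 mulgV invg1 !eqxx !andbT.
  rewrite cycle1 joingG1 Zp_cycle eqxx /=.
  by rewrite -order_dvdn order_Zp1 prednK.
have dvn : (2 * r + 1)%N %| #|G|.
  have n_gt1 : 1 < 2 * r + 1 by rewrite addn1 ltnS muln_gt0.
  apply: (@dvdn_trans (2 * r + 1).*2); first by rewrite -mul2n dvdn_mull.
  rewrite -(card_dihedral n_gt1); apply: (dvdn_homg _ _ _ [set: _]%G).
  rewrite isoG.
  (* Here b is a rotation and a a reflection; x goes to a and y to b, and a^(2^k) = 1 because 2^k is
     even. *)
  have /existsP[[b a]] := isoGrp_hom (Grp_dihedral n_gt1).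
  rewrite /= !xpair_eqE => /and4P[/eqP gen /eqP bn /eqP a2 /eqP ba].
  apply/existsP; exists (a, b).
  have aV : a^-1 = a by apply/eqP; rewrite eq_invg_mul -(expgS a 1) a2.
  have -> : (2 ^ k = 2 * 2 ^ k.-1)%N by rewrite -expnS prednK.
  rewrite /= !xpair_eqE /= expgM a2 expg1n bn joingC gen !eqxx /=.
  by rewrite -ba conjgE aV mulgA.
(* Each order is at most its bound, while their product is at least the order of G, hence at least
   the product of the bounds: both are attained. *)
have le_xy : #|G| <= #[x] * #[y].
  by rewrite -genG gen_norm_cycle // mul_cardG leq_pmulr.
have co : coprime (2 ^ k) (2 * r + 1).
  by rewrite coprimeXl // coprime2n oddD mul2n odd_double.
have dvx : #[x] %| 2 ^ k by rewrite order_dvdn xm.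
have dvy : #[y] %| 2 * r + 1 by rewrite order_dvdn yn.
have le_mn : 2 ^ k * (2 * r + 1) <= #[x] * #[y].
  by apply: leq_trans le_xy; rewrite dvdn_leq ?cardG_gt0 // Gauss_dvd ?dvm.
have m_gt0 : 0 < 2 ^ k by rewrite expn_gt0.
have n_gt0 : 0 < 2 * r + 1 by rewrite addn1.
have le_x := dvdn_leq m_gt0 dvx; have le_y := dvdn_leq n_gt0 dvy.
split; apply/eqP; rewrite eqn_leq ?le_x ?le_y /=.
  rewrite -(leq_pmul2r n_gt0) (leq_trans le_mn) //.
  by rewrite leq_mul2l le_y orbT.
rewrite -(leq_pmul2l m_gt0) (leq_trans le_mn) //.
by rewrite leq_mul2r le_x orbT.
Qed.

Theorem mainTheorem9 (k r : nat) (hk : (2 < k)%N) (hr : (1 <= r)%N)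
    (gT : finGroupType) (G : {group gT}) (x y : gT) (hG : isD k r G x y) :
  [/\ classes G =
        [set class_even x l | l : 'I_(2 ^ (k - 1))]
        :|: [set class_pair x y l q.+1 | l : 'I_(2 ^ (k - 1)), q : 'I_r]
        :|: [set class_odd x y r l | l : 'I_(2 ^ (k - 1))],
      #|classes G| = (2 ^ (k - 1) * (r + 2))%N,
      forall l : nat, (l < 2 ^ (k - 1))%N -> #|class_even x l| = 1%N,
      forall l q : nat, (l < 2 ^ (k - 1))%N -> (1 <= q <= r)%N ->
        #|class_pair x y l q| = 2
    & forall l : nat, (l < 2 ^ (k - 1))%N ->
        #|class_odd x y r l| = (2 * r + 1)%N].
Proof.
have k_gt0 : 0 < k by apply: ltn_trans hk.
have [ox oy] := isD_orders _ _ _ _ _ _ k_gt0 hr hG.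
have [_ genG _ _ yx] := hG.
have tixy : <[x]> :&: <[y]> = 1.
  apply: coprime_TIg; rewrite -!orderE ox oy.
  by rewrite coprimeXl // coprime2n oddD mul2n odd_double.
have ox2 : #[x] = (2 * 2 ^ (k - 1))%N by rewrite ox -expnS subn1 prednK.
split.
- exact: classes_listed.
- exact: (card_classes_listed _ _ _ _ _ _ yx).
- by move=> l _; rewrite cards1.
- by move=> l q _; exact: (card_class_pair _ _ _ _ oy).
- by move=> l _; apply: card_class_odd.
Qed.
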